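(* Let $(X,\sigma)$ be a support on an extriangulated category $\mathcal{E}$ and $x\in X$. (1) If $(X,\sigma)$ is a Noetherian sober closed support, then $\mathcal{P}_{X,\sigma}(x)=\mathcal{S}_{X,\sigma}(x)$. (2) If $(X,\sigma)$ is an open support, then $\mathcal{P}_{X,\sigma}(x)=\mathcal{N}_{X,\sigma}(x)$.
   Context: A support for an extriangulated category $\mathcal{E}$ is a pair $(X,\sigma)$ with $X$ a topological space and $\sigma$ an assignment of a subset $\sigma(E)\subseteq X$ to each object $E$ of $\mathcal{E}$ such that $\sigma(0)=\emptyset$ and $\sigma(E\oplus F)=\sigma(E)\cup\sigma(F)$ for all $E,F$ (direct sums being defined up to isomorphism, $\sigma$ depends only on isomorphism classes). It is a Noetherian (resp. sober) support if $X$ is Noetherian (resp. sober), and a closed (resp. open) support if every $\sigma(E)$ is closed (resp. open) in $X$. For $x\in X$ let $W_x:=\{x'\in X: x\notin\overline{\{x'\}}\}$ and define the full subcategories $$\mathcal{P}_{X,\sigma}(x):=\{E\in\mathcal{E}: x\notin\sigma(E)\},\quad \mathcal{S}_{X,\sigma}(x):=\{E\in\mathcal{E}:\sigma(E)\subseteq W_x\},\quad \mathcal{N}_{X,\sigma}(x):=\{E\in\mathcal{E}:\sigma(E)\subseteq X\setminus\overline{\{x\}}\}.$$ *)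

(* Defs.v *)
From HB Require Import structures.
From mathcomp Require Import all_boot all_order all_algebra.
From mathcomp Require Import all_classical all_reals.
From mathcomp Require Import topology.

Set Implicit Arguments.
Unset Strict Implicit.
Unset Printing Implicit Defensive.

Import GRing.Theory.

Local Open Scope classical_set_scope.
Local Open Scope ring_scope.

Declare Scope cat_scope.
Local Open Scope cat_scope.

(* Morphisms compose in applicative order.  Since every type carries a classical
   choice structure, asking Hom-sets and Ext-groups to be [zmodType]s only asks
   for abelian groups. *)
Record preadditiveCat := PreadditiveCat {
  ob :> Type;
  Hom : ob -> ob -> zmodType;
  idm : forall A, Hom A A;
  compm : forall A B C, Hom B C -> Hom A B -> Hom A C;
  comp1m : forall A B (f : Hom A B), compm (idm B) f = f;
  compm1 : forall A B (f : Hom A B), compm f (idm A) = f;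
  compA : forall A B C D (h : Hom C D) (g : Hom B C) (f : Hom A B),
    compm h (compm g f) = compm (compm h g) f;
  compDl : forall A B C (g g' : Hom B C) (f : Hom A B),
    compm (g + g') f = compm g f + compm g' f;
  compDr : forall A B C (g : Hom B C) (f f' : Hom A B),
    compm g (f + f') = compm g f + compm g f'
}.
Arguments Hom {_} A B.
Arguments idm {_} A.
Arguments compm {_ A B C} g f.

Notation "g \co f" := (compm g f) (at level 40, left associativity) : cat_scope.

Definition is_zero (C : preadditiveCat) (Z : C) : Prop :=
  (forall A (f : Hom A Z), f = 0) /\ (forall A (f : Hom Z A), f = 0).

Definition is_iso (C : preadditiveCat) (A B : C) (f : Hom A B) : Prop :=
  exists g : Hom B A, g \co f = idm A /\ f \co g = idm B.

(* A direct sum of A and B, given with its injections and projections; an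
   element of [biproduct A B] is one representative of "A (+) B", which is
   defined up to isomorphism. *)
Record biproduct (C : preadditiveCat) (A B : C) := Biproduct {
  bi_ob :> C;
  bi_i1 : Hom A bi_ob;
  bi_i2 : Hom B bi_ob;
  bi_p1 : Hom bi_ob A;
  bi_p2 : Hom bi_ob B;
  bi_p1i1 : bi_p1 \co bi_i1 = idm A;
  bi_p2i2 : bi_p2 \co bi_i2 = idm B;
  bi_p1i2 : bi_p1 \co bi_i2 = 0;
  bi_p2i1 : bi_p2 \co bi_i1 = 0;
  bi_sum : bi_i1 \co bi_p1 + bi_i2 \co bi_p2 = idm bi_ob
}.

Definition bi_map (C : preadditiveCat) (A B A' B' : C)
    (S : biproduct A B) (S' : biproduct A' B')
    (f : Hom A A') (g : Hom B B') : Hom S S' :=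
  bi_i1 S' \co f \co bi_p1 S + bi_i2 S' \co g \co bi_p2 S.

Record additiveCat := AdditiveCat {
  add_cat :> preadditiveCat;
  has_zero : exists Z : add_cat, is_zero Z;
  has_biproduct : forall A B : add_cat, inhabited (biproduct A B)
}.

(* Biadditive functors C^op x C -> Ab.  [Ext E C A] is the group E(C, A) of
   extensions "from A to C"; [push a d] is a_* d and [pull c d] is c^* d. *)
Record biadditiveFunctor (T : additiveCat) := BiadditiveFunctor {
  Ext : T -> T -> zmodType;
  push : forall C A A', Hom A A' -> Ext C A -> Ext C A';
  pull : forall C C' A, Hom C' C -> Ext C A -> Ext C' A;
  push_id : forall C A (d : Ext C A), push (idm A) d = d;
  push_comp : forall C A A' A'' (a' : Hom A' A'') (a : Hom A A') (d : Ext C A),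
    push (a' \co a) d = push a' (push a d);
  pull_id : forall C A (d : Ext C A), pull (idm C) d = d;
  pull_comp : forall C C' C'' A (c : Hom C' C) (c' : Hom C'' C') (d : Ext C A),
    pull (c \co c') d = pull c' (pull c d);
  push_pull : forall C C' A A' (a : Hom A A') (c : Hom C' C) (d : Ext C A),
    push a (pull c d) = pull c (push a d);
  push_addr : forall C A A' (a : Hom A A') (d d' : Ext C A),
    push a (d + d') = push a d + push a d';
  pull_addr : forall C C' A (c : Hom C' C) (d d' : Ext C A),
    pull c (d + d') = pull c d + pull c d';
  push_addl : forall C A A' (a a' : Hom A A') (d : Ext C A),
    push (a + a') d = push a d + push a' d;
  pull_addl : forall C C' A (c c' : Hom C' C) (d : Ext C A),
    pull (c + c') d = pull c d + pull c' d
}.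
Arguments Ext {T} b C A.
Arguments push {T b C A A'} a d.
Arguments pull {T b C C' A} c d.

Section Extensions.
Variables (T : additiveCat) (E : biadditiveFunctor T).

(* (a, c) : d -> d' is a morphism of E-extensions *)
Definition ext_morphism (A C A' C' : T) (d : Ext E C A) (d' : Ext E C' A')
    (a : Hom A A') (c : Hom C C') : Prop := push a d = pull c d'.

(* The direct sum of extensions: the element corresponding to (d, 0, 0, d')
   under the decomposition of E(C (+) C', A (+) A') into
   E(C, A) (+) E(C, A') (+) E(C', A) (+) E(C', A'). *)
Definition ext_sum (A C A' C' : T) (SA : biproduct A A') (SC : biproduct C C')
    (d : Ext E C A) (d' : Ext E C' A') : Ext E SC SA :=
  push (bi_i1 SA) (pull (bi_p1 SC) d) + push (bi_i2 SA) (pull (bi_p2 SC) d').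

(* equivalence of the sequences A -x-> B -y-> C and A -x'-> B' -y'-> C *)
Definition seq_equiv (A C B B' : T) (x : Hom A B) (y : Hom B C)
    (x' : Hom A B') (y' : Hom B' C) : Prop :=
  exists b : Hom B B', [/\ is_iso b, b \co x = x' & y' \co b = y].

End Extensions.

(* [realizes d x y] says that the class s(d) is that of the sequence
   A -x-> B -y-> C: by [real_ex] and [real_class], the pairs (x, y) realizing a
   given d form exactly one equivalence class.  Together with [real_mor] this
   makes s a realization, which is additive by [real_zero] and [real_sum]. *)
Record extriangulatedCat := ExtriangulatedCat {
  et_cat :> additiveCat;
  et_ext : biadditiveFunctor et_cat;
  realizes : forall A B C : et_cat,
    Ext et_ext C A -> Hom A B -> Hom B C -> Prop;
  real_ex : forall (A C : et_cat) (d : Ext et_ext C A),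
    exists (B : et_cat) (x : Hom A B) (y : Hom B C), realizes d x y;
  real_class : forall (A C B B' : et_cat) (d : Ext et_ext C A)
      (x : Hom A B) (y : Hom B C) (x' : Hom A B') (y' : Hom B' C),
    realizes d x y -> (realizes d x' y' <-> seq_equiv x y x' y');
  real_mor : forall (A B C A' B' C' : et_cat)
      (d : Ext et_ext C A) (d' : Ext et_ext C' A')
      (x : Hom A B) (y : Hom B C) (x' : Hom A' B') (y' : Hom B' C')
      (a : Hom A A') (c : Hom C C'),
    realizes d x y -> realizes d' x' y' -> ext_morphism d d' a c ->
    exists b : Hom B B', b \co x = x' \co a /\ y' \co b = c \co y;
  real_zero : forall (A C : et_cat) (S : biproduct A C),
    realizes (0 : Ext et_ext C A) (bi_i1 S) (bi_p2 S);
  real_sum : forall (A B C A' B' C' : et_cat)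
      (d : Ext et_ext C A) (d' : Ext et_ext C' A')
      (x : Hom A B) (y : Hom B C) (x' : Hom A' B') (y' : Hom B' C')
      (SA : biproduct A A') (SB : biproduct B B') (SC : biproduct C C'),
    realizes d x y -> realizes d' x' y' ->
    realizes (ext_sum SA SC d d') (bi_map SA SB x x') (bi_map SB SC y y');
  ET3 : forall (A B C A' B' C' : et_cat)
      (d : Ext et_ext C A) (d' : Ext et_ext C' A')
      (x : Hom A B) (y : Hom B C) (x' : Hom A' B') (y' : Hom B' C')
      (a : Hom A A') (b : Hom B B'),
    realizes d x y -> realizes d' x' y' -> b \co x = x' \co a ->
    exists c : Hom C C', ext_morphism d d' a c /\ y' \co b = c \co y;
  ET3op : forall (A B C A' B' C' : et_cat)
      (d : Ext et_ext C A) (d' : Ext et_ext C' A')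
      (x : Hom A B) (y : Hom B C) (x' : Hom A' B') (y' : Hom B' C')
      (b : Hom B B') (c : Hom C C'),
    realizes d x y -> realizes d' x' y' -> y' \co b = c \co y ->
    exists a : Hom A A', ext_morphism d d' a c /\ b \co x = x' \co a;
  ET4 : forall (A B C D F : et_cat)
      (d : Ext et_ext D A) (d' : Ext et_ext F B)
      (f : Hom A B) (f' : Hom B D) (g : Hom B C) (g' : Hom C F),
    realizes d f f' -> realizes d' g g' ->
    exists (E : et_cat) (u : Hom D E) (v : Hom E F) (h : Hom A C)
        (h' : Hom C E) (d'' : Ext et_ext E A),
      [/\ h = g \co f, u \co f' = h' \co g & v \co h' = g'] /\
      [/\ realizes d'' h h', realizes (push f' d') u v, pull u d'' = d
        & push f d'' = pull v d'];
  ET4op : forall (A B C D F : et_cat)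
      (d : Ext et_ext B D) (d' : Ext et_ext C F)
      (f' : Hom D A) (f : Hom A B) (g' : Hom F B) (g : Hom B C),
    realizes d f' f -> realizes d' g' g ->
    exists (E : et_cat) (u : Hom D E) (v : Hom E F) (h' : Hom E A)
        (h : Hom A C) (d'' : Ext et_ext C E),
      [/\ h = g \co f, h' \co u = f' & f \co h' = g' \co v] /\
      [/\ realizes d'' h' h, realizes (pull g' d) u v, d' = push v d''
        & push u d = pull g d'']
}.

Section Spaces.
Variable X : topologicalType.

Definition noetherian_space : Prop :=
  forall F : nat -> set X, (forall n, closed (F n)) ->
    (forall n, F n.+1 `<=` F n) ->
    exists N, forall n, (N <= n)%N -> F n = F N.

Definition irreducible_set (Z : set X) : Prop :=
  Z !=set0 /\
  forall F G : set X, closed F -> closed G -> Z `<=` F `|` G ->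
    Z `<=` F \/ Z `<=` G.

Definition sober_space : Prop :=
  forall Z : set X, closed Z -> irreducible_set Z ->
    exists! x : X, Z = closure [set x].

End Spaces.

Record support_data (E : extriangulatedCat) (X : topologicalType) := SupportData {
  supp :> E -> set X;
  supp_zero : forall Z : E, is_zero Z -> supp Z = set0;
  supp_sum : forall (A B : E) (S : biproduct A B),
    supp S = supp A `|` supp B
}.

(* As [supp_sum] ranges over all representatives of a direct sum, a support is
   automatically invariant under isomorphism. *)
Lemma supp_iso (E : extriangulatedCat) (X : topologicalType)
    (sigma : support_data E X) (A B : E) (f : Hom A B) :
  is_iso f -> sigma A = sigma B.
Proof.
move=> [g [gf fg]].
have [Z Z0] := has_zero E.
have e1 : g \co (0 : Hom Z B) = 0 by apply: (proj2 Z0).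
have e2 : (0 : Hom B Z) \co f = 0 by apply: (proj1 Z0).
have e3 : (0 : Hom B Z) \co (0 : Hom Z B) = idm Z.
  by rewrite (proj2 Z0 _ (idm Z)); apply: (proj2 Z0).
have e4 : f \co g + (0 : Hom Z B) \co (0 : Hom B Z) = idm B.
  suff -> : (0 : Hom Z B) \co (0 : Hom B Z) = 0 by rewrite addr0.
  by apply: (addrI ((0 : Hom Z B) \co (0 : Hom B Z))); rewrite -compDl !addr0.
have /= := supp_sum sigma (Biproduct gf e3 e1 e2 e4).
by rewrite (supp_zero sigma Z0) setU0.
Qed.

Definition noetherian_support (E : extriangulatedCat) (X : topologicalType)
  (sigma : support_data E X) : Prop := noetherian_space X.

Definition sober_support (E : extriangulatedCat) (X : topologicalType)
  (sigma : support_data E X) : Prop := sober_space X.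

Definition closed_support (E : extriangulatedCat) (X : topologicalType)
  (sigma : support_data E X) : Prop := forall A : E, closed (sigma A).

Definition open_support (E : extriangulatedCat) (X : topologicalType)
  (sigma : support_data E X) : Prop := forall A : E, open (sigma A).

Definition W (X : topologicalType) (x : X) : set X :=
  [set x' | ~ closure [set x'] x].

(* A full subcategory is identified with its class of objects. *)
Definition Psub (E : extriangulatedCat) (X : topologicalType)
  (sigma : support_data E X) (x : X) : set E := [set A | ~ sigma A x].

Definition Ssub (E : extriangulatedCat) (X : topologicalType)
  (sigma : support_data E X) (x : X) : set E := [set A | sigma A `<=` W x].

Definition Nsub (E : extriangulatedCat) (X : topologicalType)
  (sigma : support_data E X) (x : X) : set E :=
  [set A | sigma A `<=` ~` closure [set x]].

(* Main.v *)
(* A closed set containing a point contains the closure of that point.  Part (1)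
   applies this to the supports themselves, part (2) to their complements; the
   converse inclusions only use that a point lies in its own closure. *)
Require Import Defs.
From mathcomp Require Import all_boot all_order all_algebra.
From mathcomp Require Import all_classical all_reals.
From mathcomp Require Import topology.

Lemma mem_closure1 (X : topologicalType) (x : X) : closure [set x]%classic x.
Proof. exact: subset_closure. Qed.

(** By [closureE] the closure is the smallest closed superset, and [F] is a closed superset of
    [[set x]]. *)
Lemma closed_closure1_subset {X : topologicalType} {F : set X} {x : X} :
  closed F -> F x -> (closure [set x] `<=` F)%classic.
Proof.
by move=> clF Fx; rewrite closureE; apply: smallest_sub => // _ ->.
Qed.

Theorem lemma5p1 (E : extriangulatedCat) (X : topologicalType)
    (sigma : support_data E X) (x : X) :
  (noetherian_support sigma -> sober_support sigma -> closed_support sigma ->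
     Psub sigma x = Ssub sigma x) /\
  (open_support sigma -> Psub sigma x = Nsub sigma x).
Proof.
split=> [_ _ cl_sigma | op_sigma]; apply/seteqP; split=> A /=.
(* [xy] puts [x] in the closure of [y], the negation of [W x y]; the closed set [sigma A] contains
   [y], hence [x]. *)
- by move=> nAx y Ay xy; exact: nAx (closed_closure1_subset (cl_sigma A) Ay _ xy).
- by move=> sAW Ax; exact: (sAW x Ax) (mem_closure1 _ x).
(* The roles are swapped: [xy] now puts [y] in the closure of [x], so the closed complement of
   [sigma A] passes from [x] to [y], against [Ay]. *)
- move=> nAx y Ay xy.
  exact: (closed_closure1_subset (open_closedC (op_sigma A)) nAx) y xy Ay.
- by move=> sAN Ax; exact: (sAN x Ax) (mem_closure1 _ x).
Qed.
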